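(* Let $m,q$ be positive integers and let $(\Delta^{(n)}_{m,q})_{n\ge0}$ be the iterated $q$-cones with initial condition $m$. Let $\bm F_{m,q}=(f_{n,k})_{n,k\ge0}$ be the infinite matrix whose $n$-th row is $(f_{n,0},\ldots,f_{n,n},0,0,\ldots)$, the $f$-vector of $\Delta^{(n)}_{m,q}$ ($f_{n,k}$ = number of $k$-dimensional faces), and let $P_n(x)=\sum_k f_{n,k}x^k$ be the $f$-polynomial of $\Delta^{(n)}_{m,q}$. Then: (a) $P_0(x)=m$ and $P_n(x)=(qx+1)P_{n-1}(x)+q$ for $n\ge1$. (b) $\bm F_{m,q}$ is a Riordan matrix; namely $\bm F_{m,q}=T\!\left(\frac{m+(q-m)x}{q(1-x)}\,\Big|\,\frac{1-x}{q}\right)$. (c) $f_{0,0}=m$, $f_{n,0}=f_{n-1,0}+q$ for $n\ge1$, and $f_{n,k}=f_{n-1,k}+qf_{n-1,k-1}$ for all $n,k\ge1$. (d) For all $n,k\ge0$, $f_{n,k}=\left[q\binom{n}{k+1}+m\binom nk\right]q^k$. (e) $P_n(x)=m(qx+1)^{n}+q\sum_{j=0}^{n-1}(qx+1)^j$.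
   Context: $[k]$ denotes the $0$-dimensional simplicial complex with $k$ vertices. The join is $\mathcal F*\mathcal K=\{\sigma\cup\tau:\sigma\in\mathcal F\cup\{\emptyset\},\tau\in\mathcal K\cup\{\emptyset\}\}$ (on disjoint vertex sets). Define $\Delta^{(0)}_{m,q}=[m]$ and $\Delta^{(n)}_{m,q}=\Delta^{(n-1)}_{m,q}*[q]$ for $n\ge1$ (with $q$ new vertices each time). For $\alpha,\omega\in\mathbb C[[x]]$ with $\alpha(0),\omega(0)\ne0$, $T(\alpha\mid\omega)$ is the infinite lower triangular matrix $(d_{ij})_{i,j\ge0}$ with $d_{ij}=[x^i]\,x^j\alpha(x)/\omega(x)^{j+1}$; such matrices are called Riordan matrices. *)

(* Defs.v *)
From HB Require Import structures.
From mathcomp Require Import all_boot all_order all_algebra.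
From mathcomp Require Import boolp reals.
From mathcomp Require Import complex.

Set Implicit Arguments.
Unset Strict Implicit.
Unset Printing Implicit Defensive.

Import GRing.Theory.
Local Open Scope ring_scope.

(* The closure condition only concerns nonempty subsets, so that the empty set
   may or may not be listed among the faces; as it has dimension -1, this has
   no influence on the numbers f_k, k >= 0. *)
Record scomplex := SComplex {
  vertex : finType;
  faces : {set {set vertex}};
  vertex_face : forall v : vertex, [set v] \in faces;
  face_closed : forall s t : {set vertex},
    s \in faces -> t \subset s -> t != set0 -> t \in faces
}.

Section Points.
Variable k : nat.

Definition points_faces : {set {set 'I_k}} := [set [set i] | i : 'I_k].

Fact points_vertex_face (v : 'I_k) : [set v] \in points_faces.
Proof. exact: imset_f. Qed.

Fact points_face_closed (s t : {set 'I_k}) :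
  s \in points_faces -> t \subset s -> t != set0 -> t \in points_faces.
Proof.
case/imsetP=> i _ ->; rewrite subset1 => /orP[/eqP-> _|/eqP->].
  exact: imset_f.
by rewrite eqxx.
Qed.

Definition points : scomplex :=
  SComplex points_vertex_face points_face_closed.

End Points.

Section Join.
Variables F K : scomplex.

(* The sum type makes the two vertex sets disjoint. *)
Definition join_faces : {set {set vertex F + vertex K}} :=
  [set inl @: s :|: inr @: t | s : {set vertex F} in set0 |: faces F,
                               t : {set vertex K} in set0 |: faces K].

Fact join_vertex_face (v : vertex F + vertex K) : [set v] \in join_faces.
Proof.
case: v => v; apply/imset2P.
  exists [set v] set0; rewrite ?imset0 ?imset_set1 ?setU0 // !inE ?eqxx //.
  by rewrite vertex_face orbT.
exists set0 [set v]; rewrite ?imset0 ?imset_set1 ?set0U // !inE ?eqxx //.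
by rewrite vertex_face orbT.
Qed.

Fact join_face_closed (s t : {set vertex F + vertex K}) :
  s \in join_faces -> t \subset s -> t != set0 -> t \in join_faces.
Proof.
case/imset2P=> a b aF bK -> /subsetP sub _.
have sub0 (L : scomplex) (c d : {set vertex L}) :
    c \in set0 |: faces L -> d \subset c -> d \in set0 |: faces L.
  rewrite !inE; case: (eqVneq d set0) => //= d0.
  case/orP=> [/eqP->|cL dc]; first by rewrite subset0 (negbTE d0).
  exact: face_closed cL dc d0.
apply/imset2P; exists [set x | inl x \in t] [set y | inr y \in t].
- apply: sub0 aF _; apply/subsetP=> x; rewrite inE => /sub.
  by rewrite inE => /orP[] /imsetP[z zI] // [->].
- apply: sub0 bK _; apply/subsetP=> y; rewrite inE => /sub.
  by rewrite inE => /orP[] /imsetP[z zI] // [->].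
apply/setP=> v; rewrite inE; apply/idP/orP => [vt | []].
- by case: v vt => v vt; [left|right]; apply: imset_f; rewrite inE.
- by case/imsetP=> x /=; rewrite inE => xt ->.
- by case/imsetP=> x /=; rewrite inE => xt ->.
Qed.

Definition join : scomplex := SComplex join_vertex_face join_face_closed.

End Join.

Fixpoint iterated_cone (m q n : nat) : scomplex :=
  if n is n'.+1 then join (iterated_cone m q n') (points q) else points m.

Definition f_number (K : scomplex) (k : nat) : nat :=
  #|[set s in faces K | #|s| == k.+1]|.

(* A face has at most #|vertex K| vertices, so no face is left out. *)
Definition f_polynomial (K : scomplex) : {poly int} :=
  \poly_(k < #|vertex K|) (f_number K k)%:R.

(* Formal power series; a series coerces to its coefficient function. *)
Record fps (F : fieldType) := Fps { fps_coef :> nat -> F }.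

Section FpsRing.
Variable F : fieldType.
Implicit Types a b c : fps F.

HB.instance Definition _ := gen_eqMixin (fps F).
HB.instance Definition _ := gen_choiceMixin (fps F).

Lemma fpsP a b : (forall n, a n = b n) -> a = b.
Proof. by case: a b => [a] [b] /= /funext ->. Qed.

Definition fps_zero : fps F := Fps (fun=> 0).
Definition fps_opp a : fps F := Fps (fun n => - a n).
Definition fps_add a b : fps F := Fps (fun n => a n + b n).

Fact fps_addA : associative fps_add.
Proof. by move=> a b c; apply: fpsP => n /=; rewrite addrA. Qed.
Fact fps_addC : commutative fps_add.
Proof. by move=> a b; apply: fpsP => n /=; rewrite addrC. Qed.
Fact fps_add0 : left_id fps_zero fps_add.
Proof. by move=> a; apply: fpsP => n /=; rewrite add0r. Qed.
Fact fps_addN : left_inverse fps_zero fps_opp fps_add.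
Proof. by move=> a; apply: fpsP => n /=; rewrite addNr. Qed.

HB.instance Definition _ :=
  GRing.isZmodule.Build (fps F) fps_addA fps_addC fps_add0 fps_addN.

Definition fps_one : fps F := Fps (fun n => (n == 0%N)%:R).
Definition fps_mul a b : fps F :=
  Fps (fun n => \sum_(i < n.+1) a i * b (n - i)%N).

Definition fps_trunc a n : {poly F} := \poly_(i < n.+1) a i.

Fact fps_mul_trunc a b n k : (k <= n)%N ->
  fps_mul a b k = (fps_trunc a n * fps_trunc b n)`_k.
Proof.
move=> le_kn; rewrite coefM /=; apply: eq_bigr => i _; rewrite !coef_poly !ltnS.
by rewrite (leq_trans (leq_subr _ _) le_kn) (leq_trans _ le_kn) // -ltnS.
Qed.

Fact fps_mulC : commutative fps_mul.
Proof.
by move=> a b; apply: fpsP => n; rewrite !(fps_mul_trunc _ _ (leqnn n)) mulrC.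
Qed.

Fact fps_mulA : associative fps_mul.
Proof.
move=> a b c; apply: fpsP => n.
have -> : fps_mul a (fps_mul b c) n
    = (fps_trunc a n * (fps_trunc b n * fps_trunc c n))`_n.
  rewrite coefM /=; apply: eq_bigr => i _; congr (_ * _).
    by rewrite coef_poly ltn_ord.
  exact: fps_mul_trunc (leq_subr _ _).
rewrite mulrA coefM /=; apply: eq_bigr => i _; congr (_ * _).
  by rewrite -(@fps_mul_trunc _ _ n) // -ltnS.
by rewrite coef_poly ltnS leq_subr.
Qed.

Fact fps_mul1 : left_id fps_one fps_mul.
Proof.
move=> a; apply: fpsP => n /=; rewrite big_ord_recl /= mul1r subn0.
by rewrite big1 ?addr0 // => i _; rewrite mul0r.
Qed.

Fact fps_mulDl : left_distributive fps_mul fps_add.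
Proof.
move=> a b c; apply: fpsP => n /=; rewrite -big_split /=.
by apply: eq_bigr => i _; rewrite mulrDl.
Qed.

Fact fps_one_neq0 : fps_one != 0 :> fps F.
Proof.
by apply/eqP => /(congr1 (fun a : fps F => a 0%N)) /= /eqP; rewrite oner_eq0.
Qed.

HB.instance Definition _ :=
  GRing.Zmodule_isComNzRing.Build (fps F)
    fps_mulA fps_mulC fps_mul1 fps_mulDl fps_one_neq0.

Definition fps_unit : pred (fps F) := fun a => a 0%N != 0.

(* The first n coefficients of 1 / a, obtained by solving a * b = 1 degree by
   degree. *)
Fixpoint fps_inv_seq a (n : nat) : seq F :=
  if n is n'.+1 then
    let s := fps_inv_seq a n' in
    rcons s ((a 0%N)^-1 *
             ((n' == 0%N)%:R - \sum_(i < n') a i.+1 * s`_(n' - i.+1)))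
  else [::].

(* As required by unitRingType, the inverse of a non-unit is itself. *)
Definition fps_inv a : fps F :=
  if fps_unit a then Fps (fun n => (fps_inv_seq a n.+1)`_n) else a.

Fact size_fps_inv_seq a n : size (fps_inv_seq a n) = n.
Proof. by elim: n => //= n IHn; rewrite size_rcons IHn. Qed.

Fact nth_fps_inv_seq a n k : (k < n)%N ->
  (fps_inv_seq a n)`_k = (fps_inv_seq a k.+1)`_k.
Proof.
elim: n => // n IHn; rewrite ltnS leq_eqVlt => /orP[/eqP-> //|lt_kn].
by rewrite [in LHS]/= nth_rcons size_fps_inv_seq lt_kn IHn.
Qed.

Fact fps_mulVr : {in fps_unit, left_inverse 1 fps_inv *%R}.
Proof.
move=> a a0; rewrite mulrC; apply: fpsP => n.
rewrite /fps_inv (a0 : fps_unit a) [in LHS]/GRing.mul /= big_ord_recl /= subn0.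
rewrite nth_rcons size_fps_inv_seq ltnn eqxx mulrA divff // mul1r.
rewrite -addrA addrC [X in X + _](_ : _ = 0) ?add0r //.
apply/eqP; rewrite addrC subr_eq0; apply/eqP/eq_bigr => i _.
rewrite /bump /= add1n; congr (_ * _).
by rewrite (@nth_fps_inv_seq _ n) //= ltn_subrL (leq_ltn_trans _ (ltn_ord i)).
Qed.

Fact fps_unitP a b : b * a = 1 -> fps_unit a.
Proof.
move=> /(congr1 (fun c : fps F => c 0%N)); rewrite [in LHS]/GRing.mul /=.
rewrite big_ord1 subnn => ba1; apply/eqP => a0; move: ba1.
by rewrite a0 mulr0 => /esym/eqP; rewrite oner_eq0.
Qed.

Fact fps_inv_out : {in [predC fps_unit], fps_inv =1 id}.
Proof. by move=> a na; rewrite /fps_inv (negbTE (na : ~~ fps_unit a)). Qed.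

HB.instance Definition _ :=
  GRing.ComNzRing_hasMulInverse.Build (fps F) fps_mulVr fps_unitP fps_inv_out.

Definition fpsX : fps F := Fps (fun n => (n == 1%N)%:R).

Definition riordan_entry (alpha omega : fps F) (i j : nat) : F :=
  (fpsX ^+ j * (alpha / omega ^+ j.+1)) i.

(* M = T(alpha | omega), including the requirement that alpha and omega are
   admissible. *)
Definition riordan_with (M : nat -> nat -> F) (alpha omega : fps F) : Prop :=
  [/\ alpha 0%N != 0, omega 0%N != 0
    & forall i j, M i j = riordan_entry alpha omega i j].

Definition is_riordan (M : nat -> nat -> F) : Prop :=
  exists alpha omega : fps F, riordan_with M alpha omega.

End FpsRing.

Arguments fpsX {F}.

(* Main.v *)
(** Adjoining the empty face turns the f-vector of a join into the convolution
    of the f-vectors, whence f_{n,k} = f_{n-1,k} + q f_{n-1,k-1} with the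
    convention f_{n,-1} = 1.  The polynomial identities and the closed form
    follow by induction; in terms of the column generating series C_k the
    recurrence reads (1 - x) C_{k+1} = q x C_k, which together with the value
    of C_0 is the defining property of the Riordan matrix. *)
Require Import Defs.
From HB Require Import structures.
From mathcomp Require Import all_boot all_order all_algebra.
From mathcomp Require Import boolp reals.
From mathcomp Require Import complex.
From mathcomp Require Import ring.

Set Implicit Arguments.
Unset Strict Implicit.
Unset Printing Implicit Defensive.

Import GRing.Theory.
Local Open Scope ring_scope.

(* Indexed by cardinality, not by dimension. *)
Definition face_count (K : scomplex) (n : nat) : nat :=
  #|[set s in set0 |: faces K | #|s| == n]|.

Lemma face_count0 (K : scomplex) : face_count K 0 = 1%N.
Proof.
rewrite /face_count (_ : [set _ in _ | _] = [set set0]) ?cards1 //.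
by apply/setP => s; rewrite !inE cards_eq0; case: (s == set0); rewrite ?andbF.
Qed.

Lemma face_countS (K : scomplex) (k : nat) :
  face_count K k.+1 = f_number K k.
Proof.
apply: eq_card => s; rewrite !inE.
by case: eqVneq => [->|]; rewrite ?cards0 ?andbF.
Qed.

(** * Faces of a join as pairs of faces *)

Definition union_sum (S T : finType) (p : {set S} * {set T}) : {set S + T} :=
  inl @: p.1 :|: inr @: p.2.

Section UnionSum.
Variables S T : finType.
Implicit Types p : {set S} * {set T}.

Lemma mem_inl_union_sum p x : (inl x \in union_sum p) = (x \in p.1).
Proof.
rewrite inE mem_imset; last by move=> ? ? [].
by rewrite orb_idr // => /imsetP[].
Qed.

Lemma mem_inr_union_sum p y : (inr y \in union_sum p) = (y \in p.2).
Proof.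
rewrite inE orbC mem_imset; last by move=> ? ? [].
by rewrite orb_idr // => /imsetP[].
Qed.

(** The traces on the two summands recover the pair; this turns counting faces of a join into
    counting pairs. *)
Lemma union_sum_inj : injective (@union_sum S T).
Proof.
move=> [a b] [c d] /setP eq_u; congr (_, _); apply/setP => z.
  by have := eq_u (inl z); rewrite !mem_inl_union_sum.
by have := eq_u (inr z); rewrite !mem_inr_union_sum.
Qed.

Lemma card_union_sum p : #|union_sum p| = (#|p.1| + #|p.2|)%N.
Proof.
rewrite cardsU (_ : _ :&: _ = set0) ?cards0 ?subn0.
  by rewrite !card_imset // => ? ? [].
apply/setP => z; rewrite !inE; apply/negP => /andP[/imsetP[x _ ->]].
by case/imsetP.
Qed.

End UnionSum.

(** Splitting along the two vertex sets is bijective and cardinalities add; sorting the pairs by the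
    size of the first component gives the convolution. *)
Lemma face_count_join (F K : scomplex) (n : nat) :
  face_count (join F K) n =
  (\sum_(i < n.+1) face_count F i * face_count K (n - i))%N.
Proof.
pose D := [set p | [&& p.1 \in set0 |: faces F, p.2 \in set0 |: faces K
                     & #|p.1| + #|p.2| == n]%N].
have -> : face_count (join F K) n = #|D|.
  rewrite -(card_imset _ (@union_sum_inj _ _)) /face_count.
  apply: eq_card => s; rewrite in_set.
  apply/andP/imsetP => [[+ /eqP sn]|[p]].
    rewrite in_setU1 => /orP[/eqP s0|].
      exists (set0, set0); last by rewrite /union_sum !imset0 setU0.
      by rewrite inE /= !setU11 !cards0 -sn s0 cards0.
    case/imset2P=> a b aF bK s_ab; exists (a, b) => //.
    by rewrite inE /= aF bK -sn s_ab -(card_union_sum (a, b)) /=.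
  rewrite inE => /and3P[aF bK /eqP pn] ->; split.
    (* [join_faces] itself contains the empty set, so this disjunct also covers the pair of empty
       sets. *)
    by rewrite in_setU1; apply/orP; right; apply/imset2P; exists p.1 p.2.
  by rewrite card_union_sum pn.
(* The default value of [inord] is harmless: on [D] the first component has at most [n] elements. *)
pose size1 (p : {set vertex F} * {set vertex K}) : 'I_n.+1 := inord #|p.1|.
rewrite -sum1_card (partition_big size1 xpredT) //=.
apply: eq_bigr => i _; rewrite sum1dep_card -cardsX; apply: eq_card => p.
rewrite !inE; apply/andP/andP => [[/and3P[aF bK /eqP pn] /eqP pi]|].
  have p1i : #|p.1| = i by rewrite -pi inordK // ltnS -pn leq_addr.
  by rewrite aF bK -(addKn #|p.1| #|p.2|) pn p1i !eqxx.
case=> /andP[-> /eqP p1] /andP[-> /eqP p2].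
have -> : size1 p = i by rewrite /size1 p1 inord_val.
by rewrite p1 p2 subnKC ?eqxx // -ltnS.
Qed.

(** * The f-vector of an iterated q-cone *)

Lemma f_number_points (q k : nat) :
  f_number (points q) k = if k is 0 then q else 0%N.
Proof.
have f_card1 s : s \in faces (points q) -> #|s| = 1%N.
  by case/imsetP => i _ ->; rewrite cards1.
case: k => [|k].
  transitivity #|faces (points q)|.
    apply: eq_card => s; rewrite inE.
    by apply: andb_idr => /f_card1 ->.
  by rewrite card_imset ?card_ord //; apply: set1_inj.
by apply: eq_card0 => s; rewrite inE; apply/andP => -[/f_card1 ->].
Qed.

(** Using [face_count K k] for the faces of dimension k - 1 covers k = 0 as well, where it counts
    the empty face. *)
Lemma f_number_cone (K : scomplex) (q k : nat) :
  f_number (join K (points q)) k = (f_number K k + q * face_count K k)%N.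
Proof.
(* Only the indices k and k + 1 survive: a face of [points q], or the empty set, has at most one
   vertex. *)
rewrite -!face_countS face_count_join 2!big_ord_recr /=.
rewrite big1 => [|[i /= lt_ik] _].
  rewrite subnn subSnn face_count0 face_countS f_number_points.
  by rewrite add0n muln1 mulnC addnC.
by rewrite subSn 1?ltnW // -(subnSK lt_ik) face_countS f_number_points muln0.
Qed.

Lemma coef_f_polynomial (K : scomplex) (k : nat) :
  (f_polynomial K)`_k = (f_number K k)%:R.
Proof.
rewrite coef_poly; case: ltnP => // le_Kk.
rewrite [f_number K k]eq_card0 // => s; rewrite inE.
apply/andP => -[_ /eqP sk]; have := max_card (mem s).
by rewrite sk leqNgt ltnS le_Kk.
Qed.

Lemma f_polynomial_points (m : nat) : f_polynomial (points m) = m%:R.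
Proof.
apply/polyP => k; rewrite coef_f_polynomial f_number_points -polyC_natr coefC.
by case: k.
Qed.

Lemma f_polynomial_cone (K : scomplex) (q : nat) :
  f_polynomial (join K (points q)) =
  (q%:R * 'X + 1) * f_polynomial K + q%:R.
Proof.
apply/polyP => k; rewrite mulrDl mul1r -mulrA -!polyC_natr !coefD coefCM coefXM.
rewrite coefC !coef_f_polynomial f_number_cone natrD natrM.
(* In degree 0 the empty face of [K] produces the constant q. *)
case: k => [|k] /=; first by rewrite face_count0; ring.
by rewrite face_countS; ring.
Qed.

(** Induction on n, with Pascal's rule applied to both binomials. *)
Lemma f_number_iterated_cone (m q n k : nat) :
  f_number (iterated_cone m q n) k =
  ((q * 'C(n, k.+1) + m * 'C(n, k)) * q ^ k)%N.
Proof.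
elim: n k => [|n IHn] k /=.
  by rewrite f_number_points; case: k => [|k]; rewrite ?bin0n /=; ring.
rewrite f_number_cone; case: k => [|k].
  by rewrite face_count0 IHn !bin0 !bin1; ring.
by rewrite face_countS !IHn !binS expnS; ring.
Qed.

Lemma f_polynomial_iterated_cone (m q n : nat) :
  f_polynomial (iterated_cone m q n) =
  m%:R * (q%:R * 'X + 1) ^+ n
  + q%:R * \sum_(0 <= j < n) (q%:R * 'X + 1) ^+ j.
Proof.
elim: n => [|n IHn].
  by rewrite big_nil mulr0 addr0 mulr1 f_polynomial_points.
(* The factor qX + 1 shifts the geometric sum, and the added q supplies its new term j = 0. *)
rewrite /= f_polynomial_cone IHn big_nat_recl //= expr0.
under [in RHS]eq_bigr do rewrite exprS.
rewrite -mulr_sumr exprS; ring.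
Qed.

(** * Power series and the columns of a Riordan matrix *)

Section Series.
Variable F : fieldType.
Implicit Type a : fps F.

Lemma fps_unitE a : (a \is a GRing.unit) = (a 0%N != 0).
Proof. by []. Qed.

Lemma coef_fpsXM a n : (fpsX * a) n = if n is n'.+1 then a n' else 0.
Proof.
case: n => [|n]; first by rewrite [LHS]big_ord1 /= mul0r.
rewrite [LHS]big_ord_recl big_ord_recl big1 /= => [|i _]; last by rewrite mul0r.
by rewrite mul0r add0r mul1r addr0 subSS subn0.
Qed.

Lemma coef_fps_natr_mul k a n : (k%:R * a) n = k%:R * a n.
Proof.
rewrite !mulr_natl; elim: k => [|k IHk]; first by rewrite !mulr0n.
by rewrite !mulrSr -IHk.
Qed.

Lemma coef_fps_natr k n : (k%:R : fps F) n = if n is 0 then k%:R else 0.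
Proof.
rewrite -[k%:R]mulr1 coef_fps_natr_mul.
by case: n => [|n]; rewrite ?mulr1 ?mulr0.
Qed.

(** As [omega] is invertible, the two equations determine the columns one after another, and the
    series x^j alpha / omega^(j+1) satisfy them. *)
Lemma riordan_with_columns (M : nat -> nat -> F) (alpha omega : fps F) :
  alpha 0%N != 0 -> omega 0%N != 0 ->
  omega * Fps (fun i => M i 0%N) = alpha ->
  (forall j, omega * Fps (fun i => M i j.+1) = fpsX * Fps (fun i => M i j)) ->
  riordan_with M alpha omega.
Proof.
move=> alpha0 omega0 col0 colS; split=> // i j.
have omegaU : omega \is a GRing.unit by rewrite fps_unitE.
suff colE : Fps (fun i => M i j) = fpsX ^+ j * (alpha / omega ^+ j.+1).
  by rewrite /riordan_entry -colE.
elim: j => [|j IHj].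
  by rewrite expr0 mul1r expr1 -col0 mulrC mulKr.
apply: (mulrI omegaU); rewrite colS IHj [in RHS]exprS [omega ^+ j.+2]exprS.
rewrite invrM ?unitrX //.
rewrite [RHS](_ : _ = omega / omega *
    (fpsX * (fpsX ^+ j * (alpha / omega ^+ j.+1)))).
  by rewrite divrr // mul1r.
by ring.
Qed.

End Series.

Lemma iterated_cone_riordan (F : fieldType) (m q : nat) :
  m%:R != 0 :> F -> q%:R != 0 :> F ->
  riordan_with (fun n k => (f_number (iterated_cone m q n) k)%:R : F)
    ((m%:R + (q%:R - m%:R) * fpsX) / (q%:R * (1 - fpsX)))
    ((1 - fpsX) / q%:R).
Proof.
move=> m0 q0; set x : fps F := fpsX.
have coef_num n : (m%:R + (q%:R - m%:R) * x) n =
    match n with 0 => m%:R | 1 => q%:R - m%:R | _ => 0 end.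
  (* Coefficients of sums and differences are computed termwise by definition, so such rewrites hold
     by conversion. *)
  rewrite mulrC [LHS](_ : _ = (m%:R : fps F) n + (x * (q%:R - m%:R)) n) //.
  rewrite coef_fpsXM coef_fps_natr; case: n => [|n]; first by rewrite addr0.
  rewrite add0r [LHS](_ : _ = (q%:R : fps F) n - (m%:R : fps F) n) //.
  by rewrite !coef_fps_natr; case: n => [|n] //; rewrite subr0.
have qU : (q%:R : fps F) \is a GRing.unit by rewrite fps_unitE coef_fps_natr.
have xU : 1 - x \is a GRing.unit.
  by rewrite fps_unitE [_ 0%N](_ : _ = 1 - 0) // subr0 oner_eq0.
have numU : m%:R + (q%:R - m%:R) * x \is a GRing.unit.
  by rewrite fps_unitE coef_num.
apply: riordan_with_columns.
- by rewrite -fps_unitE unitrM unitrV unitrM numU qU xU.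
- by rewrite -fps_unitE unitrM unitrV qU xU.
(* Multiplication by 1 - x takes differences: column 0 becomes m, q, q, ..., and a second factor
   leaves the numerator m + (q - m)x. *)
- set C := Fps _; set D := (1 - x) * C.
  have DE n : D n = if n is 0 then m%:R else q%:R.
    rewrite /D mulrBl mul1r [LHS](_ : _ = C n - (x * C) n) // coef_fpsXM.
    case: n => [|n]; rewrite /C /=; first by rewrite f_number_points subr0.
    by rewrite f_number_cone face_count0 muln1 natrD addrC addKr.
  suff <- : (1 - x) * D = m%:R + (q%:R - m%:R) * x.
    by rewrite invrM // [_ * D]mulrC mulrA mulrK // mulrAC.
  apply: fpsP => n; rewrite mulrBl mul1r [LHS](_ : _ = D n - (x * D) n) //.
  rewrite coef_num coef_fpsXM !DE.
  by case: n => [|[|n]]; rewrite ?DE ?subr0 ?subrr.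
move=> j; set C := Fps _; set D := Fps _.
suff CE : (1 - x) * C = q%:R * (x * D) by rewrite mulrAC CE mulrC mulKr.
rewrite mulrBl mul1r; apply: fpsP => n.
rewrite coef_fps_natr_mul [LHS](_ : _ = C n - (x * C) n) // !coef_fpsXM.
case: n => [|n]; rewrite /C /D /=.
  (* Row 0 vanishes here, since [points m] has no face of positive dimension. *)
  by rewrite f_number_points subr0 mulr0.
by rewrite f_number_cone face_countS natrD natrM addrC addKr.
Qed.

Theorem theorem5p2 (R : realType) (m q : nat) (m_gt0 : (0 < m)%N)
    (q_gt0 : (0 < q)%N) :
  let f n k : nat := f_number (iterated_cone m q n) k in
  let P n : {poly int} := f_polynomial (iterated_cone m q n) in
  let Fmq n k : R[i] := (f n k)%:R in
  let x : fps R[i] := fpsX in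
  [/\ (* a *)
      P 0%N = m%:R /\
      (forall n, (1 <= n)%N -> P n = (q%:R * 'X + 1) * P n.-1 + q%:R),
      (* b *)
      is_riordan Fmq /\
      riordan_with Fmq ((m%:R + (q%:R - m%:R) * x) / (q%:R * (1 - x)))
                       ((1 - x) / q%:R),
      (* c *)
      [/\ f 0%N 0%N = m,
          forall n, (1 <= n)%N -> f n 0%N = (f n.-1 0 + q)%N
        & forall n k, (1 <= n)%N -> (1 <= k)%N ->
            f n k = (f n.-1 k + q * f n.-1 k.-1)%N],
      (* d *)
      forall n k, f n k = ((q * 'C(n, k.+1) + m * 'C(n, k)) * q ^ k)%N
    & (* e *)
      forall n, P n = m%:R * (q%:R * 'X + 1) ^+ n
                      + q%:R * \sum_(0 <= j < n) (q%:R * 'X + 1) ^+ j].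
Proof.
(* Characteristic zero turns positivity of m and q into the nonvanishing of alpha(0) and
   omega(0). *)
have natr_neq0 k : (0 < k)%N -> k%:R != 0 :> R[i].
  by rewrite Num.Theory.pnatr_eq0 -lt0n.
have riordan_f := iterated_cone_riordan (natr_neq0 _ m_gt0) (natr_neq0 _ q_gt0).
split.
- split=> [|[|n] // _]; first exact: f_polynomial_points.
  exact: f_polynomial_cone.
- by split=> //; exists ((m%:R + (q%:R - m%:R) * fpsX) / (q%:R * (1 - fpsX))),
    ((1 - fpsX) / q%:R).
- split=> [|[|n] // _|[|n] [|k] // _ _]; rewrite ?f_number_points //.
    by rewrite /= f_number_cone face_count0 muln1.
  by rewrite /= f_number_cone face_countS.
- exact: f_number_iterated_cone.
exact: f_polynomial_iterated_cone.
Qed.
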